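(* Let $2\le k<n$, $m+1=\binom nk$, and let $\mathbf b=(b_0,\dots,b_m)\in(\mathbb Z_{\ge1})^{m+1}$ be a primitive Plücker weight vector for $k<n$. Then for every $i=0,1,\dots,m$ the vector $\overline{\mathbf b}_{(i)}$ is primitive.
   Context: Let $1\le k<n$ and $m+1=\binom nk$. A Schubert symbol for $k<n$ is a sequence $\lambda=(\lambda_1<\dots<\lambda_k)$ of integers in $\{1,\dots,n\}$ (identified with its underlying set). Write $\lambda\preceq\mu$ iff $\lambda_i\le\mu_i$ for all $i$, and fix a total order $\lambda^0<\lambda^1<\dots<\lambda^m$ of all Schubert symbols refining $\preceq$. $\mathbf b=(b_0,\dots,b_m)\in(\mathbb Z_{\ge1})^{m+1}$ is a Plücker weight vector if for all $1\le i_1<\dots<i_{k-1}\le n$ and $1\le\ell_0<\dots<\ell_k\le n$ the sum $b_{r_j}+b_{s_j}$ takes the same value for all $j\in\{0,\dots,k\}$ with $\ell_j\notin\{i_1,\dots,i_{k-1}\}$, where $\lambda^{r_j}=\{i_1,\dots,i_{k-1},\ell_j\}$ and $\lambda^{s_j}=\{\ell_0,\dots,\ell_k\}\setminus\{\ell_j\}$. A collection of positive integers is primitive if its gcd is $1$. For each $i$, $\overline{\mathbf b}_{(i)}$ is the collection consisting of $b_i$ together with all $b_j$ such that $|\lambda^j\cap\lambda^i|=k-1$. *)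

(* Defs.v *)
From HB Require Import structures.
From mathcomp Require Import all_boot.

Set Implicit Arguments.
Unset Strict Implicit.
Unset Printing Implicit Defensive.

(* Strictly increasing sequences x_1 < ... < x_d of elements of {1, ..., n};
   'I_n stands for {1, ..., n}, with values shifted down by one. *)
Record incseq (n d : nat) := IncSeq {
  incseq_val :> d.-tuple 'I_n;
  incseq_ltn : sorted (fun x y : 'I_n => x < y) incseq_val
}.

HB.instance Definition _ n d := [isSub for @incseq_val n d].
HB.instance Definition _ n d := [Equality of incseq n d by <:].
HB.instance Definition _ n d := [Choice of incseq n d by <:].
HB.instance Definition _ n d := [Countable of incseq n d by <:].
HB.instance Definition _ n d := [Finite of incseq n d by <:].

Definition supp (n d : nat) (x : incseq n d) : {set 'I_n} :=
  [set z in (x : d.-tuple 'I_n)].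

Definition schubert (k n : nat) := incseq n k.

Definition schubert_le (k n : nat) (x y : schubert k n) : Prop :=
  forall i : 'I_k, tnth x i <= tnth y i.

(* A total order on the Schubert symbols refining schubert_le, given by its
   increasing enumeration lam 0 < ... < lam m. *)
Definition schubert_enum (k n m : nat) (lam : 'I_m.+1 -> schubert k n) : Prop :=
  bijective lam /\ (forall i j, schubert_le (lam i) (lam j) -> i <= j).

(* The indices r_j and s_j are quantified and then pinned down by the sets
   underlying lam r and lam s: they exist and are unique when lam enumerates
   all Schubert symbols and tnth L j lies outside I. *)
Definition plucker_weight (k n m : nat) (lam : 'I_m.+1 -> schubert k n)
    (b : 'I_m.+1 -> nat) : Prop :=
  (forall i, 1 <= b i) /\
  forall (I : incseq n k.-1) (L : incseq n k.+1) (j j' : 'I_k.+1)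
         (r s r' s' : 'I_m.+1),
    tnth L j \notin supp I ->
    supp (lam r) = tnth L j |: supp I ->
    supp (lam s) = supp L :\ tnth L j ->
    tnth L j' \notin supp I ->
    supp (lam r') = tnth L j' |: supp I ->
    supp (lam s') = supp L :\ tnth L j' ->
    b r + b s = b r' + b s'.

Definition primitive (c : seq nat) : Prop := \big[gcdn/0]_(x <- c) x = 1.

Definition bbar (k n m : nat) (lam : 'I_m.+1 -> schubert k n)
    (b : 'I_m.+1 -> nat) (i : 'I_m.+1) : seq nat :=
  b i :: [seq b j | j <- enum 'I_m.+1 & #|supp (lam j) :&: supp (lam i)| == k.-1].

(* Main.v *)
Require Import Defs.
From mathcomp Require Import all_boot.

(** If d divides b at lambda and at all its neighbours, then d divides every
    b(mu), by induction on t = |mu \ lambda|. For t >= 2 choose x, a in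
    mu \ lambda and c, e in lambda \ mu, and put J = mu \ {x, a}; the Plücker
    condition for I = J + x and L = J + a + c + e gives
    b(J + x + a) + b(J + c + e) = b(J + x + c) + b(J + a + e),
    where the last three sets are closer to lambda than mu = J + x + a. *)

Lemma ltn_ord_trans n : transitive (fun x y : 'I_n => x < y).
Proof. by move=> y x z; apply: ltn_trans. Qed.

Lemma ltn_ord_irr n : irreflexive (fun x y : 'I_n => x < y).
Proof. by move=> x; apply: ltnn. Qed.

Lemma incseq_uniq n d (x : incseq n d) : uniq x.
Proof.
exact: sorted_uniq (@ltn_ord_trans n) (@ltn_ord_irr n) _ (incseq_ltn x).
Qed.

Lemma card_supp n d (x : incseq n d) : #|supp x| = d.
Proof. by rewrite cardsE (card_uniqP (incseq_uniq n d x)) size_tuple. Qed.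

Lemma supp_inj n d : injective (@supp n d).
Proof.
move=> x y exy; apply/val_inj/val_inj.
apply: (irr_sorted_eq (@ltn_ord_trans n) (@ltn_ord_irr n)).
- exact: incseq_ltn.
- exact: incseq_ltn.
- by move=> z; move/setP/(_ z): exy; rewrite !inE.
Qed.

(** Together with [supp_inj] this lets Schubert symbols be handled as [k]-element sets from here
    on. *)
Lemma supp_surj n d (A : {set 'I_n}) : #|A| = d -> exists x : incseq n d, supp x = A.
Proof.
move=> cA.
have sz : size (enum A) == d by rewrite -cardE cA.
have so : sorted (fun x y : 'I_n => x < y) (Tuple sz).
  (* [enum A] filters the enumeration of ['I_n], whose values are [iota 0 n]. *)
  rewrite /= {1}/enum_mem sorted_filter //; first exact: ltn_ord_trans.
  by rewrite -enumT; have := iota_ltn_sorted 0 n; rewrite -val_enum_ord sorted_map.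
by exists (IncSeq so); apply/setP=> z; rewrite inE mem_enum.
Qed.

Lemma mem_supp_tnth {n d} {x : incseq n d} {z : 'I_n} :
  z \in supp x -> exists j, tnth x j = z.
Proof. by rewrite inE => /tnthP[j ->]; exists j. Qed.

Lemma dvdn_biggcd (d : nat) (c : seq nat) :
  {in c, forall x, d %| x} -> d %| \big[gcdn/0]_(x <- c) x.
Proof.
move=> dc; rewrite big_seq; apply: (big_ind (fun x => d %| x)) => //.
by move=> x y dx dy; rewrite dvdn_gcd dx.
Qed.

Lemma biggcd_dvdn (c : seq nat) (x : nat) : x \in c -> \big[gcdn/0]_(y <- c) y %| x.
Proof.
elim: c => // y c IH; rewrite inE big_cons => /predU1P[->|/IH]; first exact: dvdn_gcdl.
exact: dvdn_trans (dvdn_gcdr _ _).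
Qed.

Section PluckerWeight.

Variables (k n m : nat) (lam : 'I_m.+1 -> schubert k n) (b : 'I_m.+1 -> nat).
Hypotheses (hlam : bijective lam) (hb : plucker_weight lam b).

Lemma schubert_index (A : {set 'I_n}) : #|A| = k -> exists j, supp (lam j) = A.
Proof.
case/supp_surj=> x <-; case: hlam => g _ gK.
by exists (g x); rewrite gK.
Qed.

(** The relation compares the exchanges at [a] and at [c], both of which lie outside [x |: J].
    Writing the size as [#|J|.+2 = k] makes [k.-1] a true predecessor. *)
Lemma three_term_plucker (J : {set 'I_n}) (x a c e : 'I_n) :
    #|J|.+2 = k -> uniq [:: x; a; c; e] -> all [predC J] [:: x; a; c; e] ->
  exists r s r' s', [/\
    [/\ supp (lam r) = a |: (x |: J), supp (lam s) = c |: (e |: J),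
     supp (lam r') = c |: (x |: J) & supp (lam s') = a |: (e |: J)]
    & b r + b s = b r' + b s'].
Proof.
move=> cJ /=; rewrite !inE !negb_or -!andbA => /and5P[xa xc xe ac /and3P[ae ce _]].
case/and5P=> xJ aJ cJ' eJ _.
have pair_card y z : y != z -> y \notin J -> z \notin J -> #|y |: (z |: J)| = k.
  by move=> yz yJ zJ; rewrite !cardsU1 !inE (negPf yz) yJ zJ.
have ax : a != x by rewrite eq_sym.
have cx : c != x by rewrite eq_sym.
have [r er] := schubert_index _ (pair_card _ _ ax aJ xJ).
have [s es] := schubert_index _ (pair_card _ _ ce cJ' eJ).
have [r' er'] := schubert_index _ (pair_card _ _ cx cJ' xJ).
have [s' es'] := schubert_index _ (pair_card _ _ ae aJ eJ).
exists r, s, r', s'; split=> //.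
have [|I eI] := @supp_surj n k.-1 (x |: J); first by rewrite cardsU1 xJ -cJ.
have [|L eL] := @supp_surj n k.+1 (a |: (c |: (e |: J))).
  by rewrite cardsU1 pair_card // !inE (negPf ac) (negPf ae) (negPf aJ).
have /mem_supp_tnth[j ej] : a \in supp L by rewrite eL !inE eqxx.
have /mem_supp_tnth[j' ej'] : c \in supp L by rewrite eL !inE eqxx orbT.
apply: (proj2 hb I L j j'); rewrite ?ej ?ej' ?eI ?eL //.
- by rewrite !inE negb_or ax.
- rewrite es setU1K // !inE negb_or ac negb_or ae; exact: aJ.
- by rewrite !inE negb_or cx.
(* Moving [c] to the front of [L] turns its removal into an instance of [setU1K]. *)
- by rewrite es' [in RHS]setUCA setU1K // !inE !negb_or eq_sym ac ce.
Qed.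

Lemma dvdn_plucker_weight (d : nat) (i : 'I_m.+1) :
    d %| b i ->
    (forall j, #|supp (lam j) :&: supp (lam i)| = k.-1 -> d %| b j) ->
  forall j, d %| b j.
Proof.
move=> di dnb j.
have [t] := ubnP #|supp (lam j) :\: supp (lam i)|; elim: t j => // t IH j.
rewrite ltnS; move eqM: (supp (lam j)) => M; move eqN: (supp (lam i)) => N le_t.
have cM : #|M| = k by rewrite -eqM card_supp.
have cN : #|N| = k by rewrite -eqN card_supp.
have eMN := cardsID N M; have eNM := cardsID M N.
(* Since [M] and [N] have equal size, two elements of [M] outside [N] will also yield two elements
   of [N] outside [M]. *)
have cD : #|M :\: N| = #|N :\: M|.
  by apply/eqP; rewrite -(eqn_add2l #|M :&: N|) eMN setIC eNM cM cN.
have [le1|gt1] := leqP #|M :\: N| 1.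
  (* A difference of size 1 makes [lam j] a neighbour of [lam i]; an empty one forces [j = i]. *)
  case: (posnP #|M :\: N|) => [D0|D1]; last first.
    apply: dnb; rewrite eqM eqN -cM -eMN.
    have -> : #|M :\: N| = 1 by apply/eqP; rewrite eqn_leq le1.
    by rewrite addn1.
  suff -> : j = i by [].
  apply: (bij_inj hlam); apply: supp_inj; apply/eqP.
  by rewrite eqEcard !card_supp leqnn andbT -setD_eq0 -cards_eq0 eqM eqN D0.
have /card_gt1P[x [a [xD aD xa]]] := gt1.
rewrite cD in gt1; have /card_gt1P[c [e [cD' eD ce]]] := gt1.
move: xD aD cD' eD; rewrite !inE => /andP[xN xM] /andP[aN aM] /andP[cM' cN'] /andP[eM eN].
have neqMN y z : y \in M -> z \notin M -> y != z by move=> yM; apply: contraNneq => <-.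
pose J := M :\ a :\ x.
have xMa : x \in M :\ a by rewrite !inE xa.
have eJ : a |: (x |: J) = M by rewrite !setD1K.
have cJ : #|J|.+2 = k.
  by rewrite -cM (cardsD1 a M) aM (cardsD1 x (M :\ a)) xMa.
have [||r [s [r' [s' [[er es er' es'] E]]]]] := three_term_plucker J x a c e cJ.
- by rewrite /= !inE !negb_or xa ce !neqMN.
- by rewrite /= !inE !eqxx (negPf cM') (negPf eM) !andbF.
have ej : j = r by apply: (bij_inj hlam); apply: supp_inj; rewrite er eJ eqM.
(* As [J] lies in [M], whatever [y |: (z |: J)] has outside [N] lies in [M :\: N]. The element [w]
   of [M :\: N] is lost, so the inclusion is strict and the induction hypothesis applies. *)
have closer w y z l : w \in M -> w \notin N -> y \in N -> z \in M :|: N ->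
    w \notin z |: J -> supp (lam l) = y |: (z |: J) -> d %| b l.
  move=> wM wN yN zMN wzJ el; apply: IH; rewrite el eqN; apply: leq_trans le_t.
  apply/proper_card/properP; split.
    apply/subsetP=> u; rewrite !inE => /andP[uN].
    rewrite uN; case/or3P=> [/eqP uy|/eqP uz|/and3P[//]].
      by rewrite uy yN in uN.
    by move: zMN; rewrite -uz inE (negPf uN) orbF.
  exists w; first by rewrite !inE wN wM.
  rewrite !inE negb_and negb_or; apply/orP; right; apply/andP; split.
    by apply: contraNneq wN => ->.
  by move: wzJ; rewrite !inE.
have ac : a != c by apply: neqMN.
have xe : x != e by apply: neqMN.
have xc : x != c by apply: neqMN.
(* Once [d] divides [b s], it divides [b r] as soon as it divides [b r + b s = b r' + b s']. The
   lost element is [a] for [r'] and [s], and [x] for [s']. *)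
rewrite ej -(dvdn_addl (n := b s)).
  rewrite E dvdn_add //.
    by apply: (closer a c x) => //; rewrite !inE ?xM // eqxx andbF orbF eq_sym.
  by apply: (closer x e a) => //; rewrite ?inE ?aM ?eqxx ?orbF // setUCA.
by apply: (closer a c e) => //; rewrite !inE ?eN ?orbT // eqxx andbF orbF neqMN.
Qed.

End PluckerWeight.

Theorem lemma3p11 (k n m : nat) (hk : 2 <= k) (hkn : k < n)
    (hm : m + 1 = 'C(n, k))
    (lam : 'I_m.+1 -> schubert k n) (hlam : schubert_enum lam)
    (b : 'I_m.+1 -> nat) (hb : plucker_weight lam b)
    (hprim : primitive [seq b i | i <- enum 'I_m.+1]) :
  forall i : 'I_m.+1, primitive (bbar lam b i).
Proof.
(* With 1 rewritten as the gcd of all weights, it suffices that the gcd of [bbar lam b i] divides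
   each [b j]. *)
move=> i; apply/eqP; rewrite -dvdn1 -[X in _ %| X]hprim.
apply: dvdn_biggcd => _ /mapP[j _ ->].
apply: (dvdn_plucker_weight _ _ _ _ _ (proj1 hlam) hb _ i) => [|l ll].
  by apply: biggcd_dvdn; rewrite inE eqxx.
apply: biggcd_dvdn; rewrite inE; apply/orP; right.
by apply: map_f; rewrite mem_filter ll eqxx mem_enum.
Qed.
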